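(* Let $g(\lambda,\omega)=p(\omega)\,q(\lambda/\delta(\omega))$ for $\lambda\in\mathbb{R}^d$, $\omega\in\mathbb{R}$, where $p(\omega)$ is positive and finite for all sufficiently large $|\omega|$, $q:\mathbb{R}^d\to[0,\infty)$ is a non-negative, continuous, integrable function that is not identically zero, and $\delta:\mathbb{R}\to(0,\infty)$ is a positive even function with a well-defined limit (finite or infinite) as $|\omega|\to\infty$. If $g$ satisfies the flattening condition, then $\lim_{|\omega|\to\infty}\delta(\omega)=\infty$.
   Context: Flattening condition: a function $g$ of $(\lambda,\omega)\in\mathbb{R}^d\times\mathbb{R}$ satisfies it if for every finite $R>0$, $$\lim_{\|(\lambda,\omega)\|\to\infty}\ \sup_{\|(u,v)\|<R}\left|\frac{g(\lambda+v,\omega+u)}{g(\lambda,\omega)}-1\right|=0,$$ where $v\in\mathbb{R}^d$, $u\in\mathbb{R}$, and the limit is along any path to infinity (in particular either $\lambda$ or $\omega$ may stay bounded or fixed while the other diverges). *)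

(* Defs.v *)
From HB Require Import structures.
From mathcomp Require Import all_boot all_order all_algebra.
From mathcomp Require Import all_classical all_reals all_analysis.

Set Implicit Arguments.
Unset Strict Implicit.
Unset Printing Implicit Defensive.

Import Order.TTheory GRing.Theory Num.Theory.
Import numFieldNormedType.Exports.

Local Open Scope classical_set_scope.
Local Open Scope ring_scope.

(* Lebesgue measure on R^n, carried by [n.-tuple R] with the product
   sigma-algebra: the image of the product measure on R * R^(n-1) under
   (x, t) |-> x :: t, starting from the Dirac mass on R^0. *)
Section lebesgue_tuple.
Context {R : realType}.
Local Notation mR := (measurableTypeR R).

Definition tuple_cons n (x : mR * n.-tuple mR) : n.+1.-tuple mR :=
  [tuple of x.1 :: x.2].

Definition tuple_uncons n (t : n.+1.-tuple mR) : mR * n.-tuple mR :=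
  (thead t, [tuple of behead t]).

Lemma tuple_consK n : cancel (@tuple_cons n) (@tuple_uncons n).
Proof. by case=> x t; congr pair; apply: val_inj. Qed.

Lemma measurable_tuple_cons n : measurable_fun setT (@tuple_cons n).
Proof. by apply: measurable_cons; [exact: measurable_fst|exact: measurable_snd]. Qed.

Lemma measurable_tuple_uncons n : measurable_fun setT (@tuple_uncons n).
Proof.
apply: (measurable_fun_pair (f := fun t : n.+1.-tuple mR => thead t)).
  exact: measurable_tnth.
exact: measurable_behead.
Qed.

Section step.
Variables (n : nat) (mu : {sigma_finite_measure set (n.-tuple mR) -> \bar R}).

Let prod_mu : {measure set (mR * n.-tuple mR)%type -> \bar R} :=
  product_measure1 (@lebesgue_measure R) mu.

Definition lebesgue_step : set (n.+1.-tuple mR) -> \bar R :=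
  pushforward (@lebesgue_measure R \x mu)%E (@tuple_cons n).

HB.instance Definition _ :=
  Measure.copy lebesgue_step
    (measure_function_pushforward__canonical__measure_function_Measure
      prod_mu (@measurable_tuple_cons n)).

Let sigma_finite_step : sigma_finite setT lebesgue_step.
Proof.
have /sigma_finiteP[F [TF ndF Foo]] := sigma_finiteT (@lebesgue_measure R).
have /sigma_finiteP[G [TG ndG Goo]] := sigma_finiteT mu.
exists (fun i => @tuple_uncons n @^-1` (F i `*` G i)).
  rewrite -preimage_bigcup -(preimage_setT (@tuple_uncons n)); congr preimage.
  rewrite -setXTT TF TG predeqE => -[x y]; split; last first.
    by move=> [i _ []/= ? ?]; split; exists i.
  move=> [/= [i _ Fix] [k _ Gky]]; exists (maxn i k) => //; split.
  - by move: x Fix; exact/subsetPset/ndF/leq_maxl.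
  - by move: y Gky; exact/subsetPset/ndG/leq_maxr.
move=> k; have [? ?] := Foo k; have [? ?] := Goo k; split.
  rewrite -[X in measurable X]setTI.
  by apply: measurable_tuple_uncons => //; exact: measurableX.
rewrite /lebesgue_step /pushforward -comp_preimage.
rewrite (_ : _ \o _ = id); last by apply/funext => x; exact: tuple_consK.
by rewrite preimage_id product_measure1E// lte_mul_pinfty// ge0_fin_numE.
Qed.

HB.instance Definition _ :=
  Measure_isSigmaFinite.Build _ _ _ lebesgue_step sigma_finite_step.
End step.

Fixpoint lebesgue_tuple n : {sigma_finite_measure set (n.-tuple mR) -> \bar R} :=
  match n with
  | 0 => dirac ([tuple] : 0.-tuple mR)
  | m.+1 => lebesgue_step (lebesgue_tuple m)
  end.

Lemma lebesgue_tuple_box n (A : 'I_n -> set mR) :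
  (forall i, measurable (A i)) ->
  lebesgue_tuple n [set t | forall i, A i (tnth t i)] =
  (\prod_(i < n) lebesgue_measure (A i))%E.
Proof.
elim: n => [|n IH] in A *; move=> mA.
  rewrite big_ord0 /= diracE mem_set//= => -[].
  by [].
rewrite big_ord_recl -IH//= -product_measure1E//; last first.
  rewrite (_ : [set t | _] =
    \bigcap_(i in [set: 'I_n]) ((@tnth n mR ^~ i) @^-1` A (lift ord0 i))).
    apply: fin_bigcap_measurable => // i _; rewrite -[X in measurable X]setTI.
    by apply: measurable_tnth => //; exact: mA.
  by apply/seteqP; split=> t /= h i => [_|]; [exact: h|exact: (h i I)].
rewrite /lebesgue_step /pushforward; congr (product_measure1 _ _ _).
apply/seteqP; split => -[x t] /=.
  by move=> h; split => [|i]; [exact: (h ord0)|have := h (lift ord0 i); rewrite tnthS].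
by move=> [hx ht] i; case: (unliftP ord0 i) => [j ->|->]; rewrite ?tnthS//=; exact: ht.
Qed.

Definition rV_of_tuple n (t : n.-tuple mR) : 'rV[R]_n := \row_i tnth t i.

Definition rV_integrable n (f : 'rV[R]_n -> R) :=
  (lebesgue_tuple n).-integrable setT (fun t => (f (rV_of_tuple t))%:E).

End lebesgue_tuple.

(* The filter for limits as `|x| tends to +oo, along any path. *)
Definition norm_infty {R : realType} (V : normedModType R) : set_system V :=
  filter_from [set: R] (fun M => [set x | M < `|x|]).
Arguments norm_infty {R} V _.

Global Instance norm_infty_filter {R : realType} (V : normedModType R) :
  Filter (norm_infty V).
Proof.
apply: filter_from_filter; first by exists 0.
move=> M N _ _; exists (Num.max M N) => // x /=.
by rewrite gt_max => /andP[].
Qed.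

(* The norm on 'rV[R]_d * R is the max norm; all norms on this space give the
   same condition.  The ratio is undefined where [g] is zero or infinite; there
   the conventions on [\bar R] (0^-1 = +oo, +oo^-1 = 0, -oo^-1 = -oo, 0 * +oo = 0)
   put it at distance at least 1 from 1, so that the condition forces [g] to be
   finite and nonzero near infinity. *)
Definition flattening {R : realType} d (g : 'rV[R]_d -> R -> \bar R) :=
  forall r : R, 0 < r ->
    ereal_sup [set `|g (z.1 + w.1)%R (z.2 + w.2)%R / g z.1 z.2 - 1|
              | w in [set w : 'rV[R]_d * R | (`|w| < r)%R]]%E
      @[z --> norm_infty ('rV[R]_d * R)%type] --> 0%E.

(* Main.v *)
(** If [delta] does not tend to infinity, it stays bounded by some [B]. At large
    [omega] the flattening condition holds for all [lambda] at once, and after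
    rescaling by [delta omega] it says that the relative oscillation of [q] on
    balls of arbitrary radius is arbitrarily small. Hence [q] is a nonzero
    constant, which is not integrable on a space of positive dimension. *)

Require Import Defs.
From HB Require Import structures.
From mathcomp Require Import all_boot all_order all_algebra.
From mathcomp Require Import all_classical all_reals all_analysis.

Set Implicit Arguments.
Unset Strict Implicit.
Unset Printing Implicit Defensive.

Import Order.TTheory GRing.Theory Num.Theory.
Import numFieldNormedType.Exports.

Local Open Scope classical_set_scope.
Local Open Scope ring_scope.

(** The whole space is a box with [n] sides of infinite length. Positivity of [n] matters: for
    [n = 0] the measure is a Dirac mass of total mass 1. *)
Lemma lebesgue_tuple_setT (R : realType) n :
  (0 < n)%N -> @lebesgue_tuple R n setT = +oo%E.
Proof.
move=> n0; have := lebesgue_tuple_box (fun _ : 'I_n => @measurableT _ R).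
rewrite (_ : [set t | _] = setT); last exact/seteqP.
move=> ->; rewrite -(prednK n0) big_const_ord /=.
have -> : lebesgue_measure [set: measurableTypeR R] = +oo%E.
  by rewrite -set_itvNyy lebesgue_measure_itv.
by elim: n.-1 => [|m IH] /=; rewrite ?mule1// IH mulyy.
Qed.

Lemma rV_integrable_cst (R : realType) n (c : R) :
  (0 < n)%N -> rV_integrable (fun _ : 'rV[R]_n => c) -> c = 0.
Proof.
move=> n0 /integrableP[_].
rewrite integral_cst// [X in (_ * X)%E](lebesgue_tuple_setT R n0).
have [->//|c0] := eqVneq c 0.
by rewrite gt0_muley ?ltxx// lte_fin normr_gt0.
Qed.

Lemma norm_infty_nontrivial (R : realType) (A : set R) :
  norm_infty R A -> exists x, A x.
Proof.
move=> [M _ MA]; exists (`|M| + 1); apply: MA => /=.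
by rewrite ger0_norm ?addr_ge0// (le_lt_trans (ler_norm M))// ltrDl.
Qed.

(* For [b = 0] the hypothesis fails: [0^-1 = +oo] makes the ratio [0] or [+oo]. *)
Lemma dist_of_eratio (R : realType) (P : \bar R) (a b e : R) :
  (0 < P < +oo)%E -> 0 <= a -> 0 <= b -> e <= 1 ->
  (`|P * a%:E / (P * b%:E) - 1| < e%:E)%E -> `|a - b| < e * b.
Proof.
case: P => [P| |]//; rewrite ?ltxx ?andbF// => /andP[].
rewrite lte_fin => P0 _ a0 b0 e1; rewrite -!EFinM.
have [->|bN0] := eqVneq b 0.
  rewrite mulr0 inve0; have [->|aN0] := eqVneq a 0.
    rewrite mulr0 mul0e add0e abseN abse1 lte_fin => /lt_le_trans-/(_ _ e1).
    by rewrite ltxx.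
  by rewrite gt0_muley// lte_fin mulr_gt0// lt_def aN0.
rewrite inver mulf_eq0 (negbTE bN0) (gt_eqF P0) -EFinM -EFinB abse_EFin lte_fin.
rewrite -mulf_div divff ?gt_eqF// mul1r -[X in `|_ - X|](divff bN0) -mulrBl normrM.
by rewrite normfV (ger0_norm b0) ltr_pdivrMr// lt_def bN0.
Qed.

(** Moving [lambda] by [delta omega *: (y - x)] carries the argument of [q] from [x] to [y]. Since
    [delta] is eventually below [B], one radius admits this shift for all large [omega]. *)
Lemma flattening_profile_cst (R : realType) (d : nat) (p : R -> \bar R)
    (q : 'rV[R]_d -> R) (delta : R -> R) (B : R) :
  (\forall omega \near norm_infty R, (0 < p omega < +oo)%E) ->
  (forall x, 0 <= q x) ->
  (forall omega, 0 < delta omega) ->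
  (\forall omega \near norm_infty R, delta omega < B) ->
  flattening (fun lambda omega =>
    p omega * (q ((delta omega)^-1 *: lambda))%:E)%E ->
  forall x y, q x = q y.
Proof.
move=> p_pos q_ge0 delta_gt0 delta_lt g_flat x y.
suff qxy e : 0 < e -> e <= 1 -> `|q y - q x| < e * q x.
  have := qxy 1 ltr01 (lexx _); rewrite mul1r => /(le_lt_trans (normr_ge0 _)) qx0.
  apply/eqP; rewrite eq_sym -subr_eq0 -normr_le0; apply/ler_addgt0Pl => e e0.
  rewrite addr0; have m0 : 0 < Num.min 1 (e / q x) by rewrite lt_min ltr01 divr_gt0.
  have := qxy _ m0; rewrite ge_min lexx => /(_ isT)/ltW/le_trans; apply.
  by rewrite -ler_pdivlMr// ge_min lexx orbT.
move=> e0 e1.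
have B0 : 0 < B.
  by have [w] := norm_infty_nontrivial delta_lt; apply: lt_trans.
(* The summand 1 keeps the radius positive when [y = x] and makes the norm bound on the shift
   strict. *)
have r0 : 0 < B * (`|y - x| + 1) by rewrite mulr_gt0// ltr_wpDl.
have /g_flat : nbhs (0%E : \bar R) [set t | (t < e%:E)%E].
  by apply: open_nbhs_nbhs; split; [exact: open_ereal_lt_ereal|rewrite /= lte_fin].
move=> /(_ _ r0)[M _ MA].
have big : \forall omega \near norm_infty R, M < `|omega| by exists M.
have [w [[Mw pw] dw]] := norm_infty_nontrivial
  (filterI (filterI big p_pos) delta_lt).
have dN0 : delta w != 0 by rewrite gt_eqF.
(* In the max norm [M < |w|] alone puts this point far out, whatever [x] is. *)
have := MA (delta w *: x, w); rewrite /= prod_normE/= lt_max Mw orbT => /(_ isT) sup_lt.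
apply: (dist_of_eratio pw) => //; apply: le_lt_trans sup_lt.
(* The second coordinate stays at [w], so numerator and denominator share the factor [p w] and the
   scale [delta w]. *)
apply: ereal_sup_ubound => /=; exists (delta w *: (y - x), 0) => /=.
  rewrite prod_normE/= normr0 gt_max r0 andbT normrZ gtr0_norm//.
  rewrite (@le_lt_trans _ _ (B * `|y - x|))//; first by rewrite ler_wpM2r// ltW.
  by rewrite ltr_pM2l// ltrDl.
by rewrite addr0 -scalerDr !scalerA mulVf// !scale1r [x + _]addrC subrK.
Qed.

Theorem mainTheorem3 (R : realType) (d : nat) (p : R -> \bar R)
    (q : 'rV[R]_d -> R) (delta : R -> R) (g : 'rV[R]_d -> R -> \bar R)
    (d_gt0 : (0 < d)%N)
    (gE : forall lambda omega,
      g lambda omega = (p omega * (q ((delta omega)^-1 *: lambda))%:E)%E)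
    (p_pos : \forall omega \near norm_infty R, (0 < p omega < +oo)%E)
    (q_ge0 : forall x, 0 <= q x)
    (q_cont : continuous q)
    (q_int : rV_integrable q)
    (q_neq0 : exists x, q x != 0)
    (delta_gt0 : forall omega, 0 < delta omega)
    (delta_even : forall omega, delta (- omega) = delta omega)
    (delta_lim : exists l : \bar R,
      (delta omega)%:E @[omega --> norm_infty R] --> l)
    (g_flat : flattening g) :
  delta omega @[omega --> norm_infty R] --> +oo.
Proof.
have gEfun : g = fun lambda omega =>
    (p omega * (q ((delta omega)^-1 *: lambda))%:E)%E.
  by apply/funext => lambda; apply/funext => omega.
have [l delta_l] := delta_lim.
have [ly|lNy] := eqVneq l +oo%E; first by apply/cvgeryP; rewrite -ly.
(* A limit other than [+oo] lies strictly below some real [B], which then bounds [delta] near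
   infinity. *)
have [B lB] : exists B : R, (l < B%:E)%E.
  case: l lNy {delta_l} => [s| |]// _; last by exists 0; rewrite ltNyr.
  by exists (s + 1); rewrite lte_fin ltrDl.
have delta_lt : \forall omega \near norm_infty R, delta omega < B.
  have /delta_l : nbhs l [set t | (t < B%:E)%E].
    by apply: open_nbhs_nbhs; split; [exact: open_ereal_lt_ereal|].
  by move=> [M _ MB]; exists M => // omega /MB; rewrite /= lte_fin.
have [x qx] := q_neq0.
rewrite gEfun in g_flat.
have q_cst := flattening_profile_cst p_pos q_ge0 delta_gt0 delta_lt g_flat.
have qE : q = fun=> q x by apply/funext => y; exact: q_cst.
rewrite qE in q_int.
by rewrite (rV_integrable_cst d_gt0 q_int) eqxx in qx.
Qed.
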